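(* Let $m\ge 1$ be an integer. For a virtual link diagram $D$ with a cut system $P$, an $m$-fold cyclic covering virtual link diagram $\varphi_m(D,P)$ is mod $m$ almost classical.
   Context: **Virtual link diagrams.** A virtual link diagram is a generically immersed closed oriented 1-manifold in $\mathbb{R}^2$ in which every double point is marked as a positive, negative (i.e. classical, with over/under information) or virtual crossing (no over/under information). A virtual path is a path (possibly a loop) on a diagram containing no classical crossing; it may pass through virtual crossings. **Semi-arcs and cut points.** A semi-arc of $D$ is a virtual path that is either an immersed arc between two classical crossings (passing straight through any virtual crossings) or an immersed loop (a component without classical crossings). An (oriented) cut point of $D$ is a point on a semi-arc, away from all crossings, with a chosen local orientation of the arc at that point. It is coherent if this local orientation agrees with the orientation of $D$, and incoherent otherwise; put $\epsilon(p)=+1$ if $p$ is coherent and $\epsilon(p)=-1$ if $p$ is incoherent. **Mod $m$ almost classical diagrams.** A mod $m$ Alexander numbering of $D$ is an assignment of an element of $\mathbb{Z}_m=\mathbb{Z}/m\mathbb{Z}$ to each semi-arc of $D$ such that around each classical crossing, drawn with both strands oriented downward, the top-left and bottom-left edges carry a common number $i$ and the top-right and bottom-right edges carry $i+1$, regardless of which strand is over. $D$ is mod $m$ almost classical if it admits a mod $m$ Alexander numbering. **Cut systems.** Let $P$ be a finite set of cut points of $D$, and cut the semi-arcs of $D$ along $P$. An Alexander numbering of $(D,P)$ is an assignment of an integer to each resulting arc or loop such that (i) around each classical crossing, drawn with both strands oriented downward, the top-left and bottom-left edges carry a common number $i\in\mathbb{Z}$ and the top-right and bottom-right edges carry $i+1$,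 regardless of which strand is over; (ii) at each cut point the number increases by exactly one when passing the cut point in the direction of its local orientation. (At virtual crossings numbers are unchanged along each strand.) $P$ is a cut system of $D$ if such an Alexander numbering exists. **The diagram $\varphi_m(D,P)$.** Let $P$ be a cut system of $D$. After a small isotopy of $\mathbb{R}^2$, assume each $p\in P$ lies on a horizontal line $\ell(p)$ that meets $D$ transversely, avoids all crossings of $D$, and contains no other cut point. Let $(D^0,P^0),\dots,(D^{m-1},P^{m-1})$ be $m$ disjoint copies of $(D,P)$, obtained by translation along the $x$-axis and appearing from left to right in this order; $p^k\in P^k$ is the copy of $p\in P$. Superscripts $k$ are read modulo $m$. For each $p^k$ remove from $\bigcup_k D^k$ a small arc of $D^k$ around $p^k$, with initial endpoint $p^k_-$ and terminal endpoint $p^k_+$ (with respect to the orientation of $D^k$). For each $p\in P$ and each $k\in\mathbb{Z}_m$ connect $p^k_-$ to $p^{k-\epsilon(p)}_+$ by an arc all of whose crossings are virtual; these arcs are drawn in a thin neighborhood of $\ell(p)$, except that the arc between the copies $0$ and $m-1$ that closes up the cycle may be any virtual path. Any resulting virtual link diagram is denoted $\varphi_m(D,P)$ and called an $m$-fold cyclic covering diagram of $(D,P)$. *)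

(* Defs.v *)
From HB Require Import structures.
From mathcomp Require Import all_boot all_order all_algebra.
From mathcomp Require Import all_classical all_reals all_analysis.

Set Implicit Arguments.
Unset Strict Implicit.
Unset Printing Implicit Defensive.

Import Order.TTheory GRing.Theory Num.Theory.
Import numFieldNormedType.Exports.

Local Open Scope classical_set_scope.
Local Open Scope ring_scope.

Definition det2 (R : realType) (u v : R * R) : R := u.1 * v.2 - u.2 * v.1.

(* Points of the disjoint union of circles I * (R / Z) are represented by
   pairs (i, t) with t a real lift, up to [same_pt]. *)
Definition same_pt (R : realType) (I : Type) (x y : I * R) : Prop :=
  x.1 = y.1 /\ exists n : int, y.2 = x.2 + n%:~R.

Definition meets (R : realType) (I : Type) (f : I -> R -> R * R)
    (x y : I * R) : Prop :=
  ~ same_pt x y /\ f x.1 x.2 = f y.1 y.2.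

Definition velocity (R : realType) (I : Type) (f : I -> R -> R * R)
    (x : I * R) : R * R := derive1 (f x.1) x.2.

Inductive crossing_kind := Positive | Negative | Virtual.

(* [mark] is only relevant at double points.  The sign of a classical crossing
   determines its over/under information, since the strands are oriented: the
   crossing is positive iff det2 (over velocity) (under velocity) > 0.
   Finiteness of the set of double points follows from the axioms, by
   compactness. *)
Record diagram (R : realType) := Diagram {
  comp : finType;
  path : comp -> R -> R * R;
  mark : R * R -> crossing_kind;
  path_periodic : forall i t, path i (t + 1) = path i t;
  path_derivable : forall i t, derivable (path i) t 1;
  path_C1 : forall i, continuous (derive1 (path i));
  path_immersed : forall i t, derive1 (path i) t != 0;
  path_transverse : forall x y, meets path x y ->
    det2 (velocity path x) (velocity path y) != 0;
  path_no_triple : forall x y z,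
    ~ (meets path x y /\ meets path y z /\ meets path x z)
}.

Definition pt (R : realType) (D : diagram R) : Type := (comp D * R)%type.

Definition at_crossing (R : realType) (D : diagram R) (x : pt D) : Prop :=
  exists y, meets (@path R D) x y.

Definition at_classical (R : realType) (D : diagram R) (x : pt D) : Prop :=
  at_crossing x /\ mark D (path x.1 x.2) <> Virtual.

Record cut_points (R : realType) (D : diagram R) := CutPoints {
  cut : finType;
  cut_pos : cut -> pt D;
  coherent : cut -> bool;
  cut_distinct : forall p q, same_pt (cut_pos p) (cut_pos q) -> p = q;
  cut_away : forall p, ~ at_crossing (cut_pos p)
}.

Definition at_cut (R : realType) (D : diagram R) (P : cut_points D)
    (x : pt D) : Prop :=
  exists p : cut P, same_pt (cut_pos p) x.

(* A labelling of the arcs and loops obtained by cutting the circles at the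
   points satisfying [brk], given as a function on points; its values at
   points satisfying [brk] are irrelevant. *)
Definition labelling (R : realType) (T : Type) (D : diagram R)
    (brk : pt D -> Prop) (nu : comp D -> R -> T) : Prop :=
  (forall i t, nu i (t + 1) = nu i t) /\
  (forall i (a b : R), a <= b ->
    (forall t, a <= t <= b -> ~ brk (i, t)) -> nu i a = nu i b).

(* When both strands of a crossing are drawn downward, the strand x with
   det2 (velocity x) (velocity y) < 0 goes from the top left to the bottom
   right, and y goes from the top right to the bottom left. *)
Definition crossing_rule (R : realType) (T : Type) (succ : T -> T)
    (D : diagram R) (nu : comp D -> R -> T) : Prop :=
  forall x y : pt D, at_classical x -> meets (@path R D) x y ->
    det2 (velocity (@path R D) x) (velocity (@path R D) y) < 0 ->
    exists n : T, \forall e \near 0^'+,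
      [/\ nu x.1 (x.2 - e) = n,
          nu y.1 (y.2 + e) = n,
          nu y.1 (y.2 - e) = succ n &
          nu x.1 (x.2 + e) = succ n].

(* Z / m Z is represented by 'I_m with the cyclic successor [ordS] as i + 1;
   unlike 'Z_m this is also correct for m = 1. *)
Definition mod_almost_classical (R : realType) (m : nat) (D : diagram R) :
    Prop :=
  exists nu : comp D -> R -> 'I_m,
    labelling (@at_classical R D) nu /\ crossing_rule (@ordS m) nu.

Definition cut_rule (R : realType) (D : diagram R) (P : cut_points D)
    (nu : comp D -> R -> int) : Prop :=
  forall p : cut P, let x := cut_pos p in
    \forall e \near 0^'+,
      if coherent p then nu x.1 (x.2 + e) = nu x.1 (x.2 - e) + 1
      else nu x.1 (x.2 - e) = nu x.1 (x.2 + e) + 1.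

Definition cut_system (R : realType) (D : diagram R) (P : cut_points D) :
    Prop :=
  exists nu : comp D -> R -> int,
    [/\ labelling (fun x => at_classical x \/ at_cut P x) nu,
        crossing_rule (fun n : int => n + 1) nu &
        cut_rule P nu].

(* Ambient C^1 isotopies of the plane.  Letting time range over R rather than
   [0, 1] loses nothing, as an isotopy extends by constants. *)
Record isotopy (R : realType) := Isotopy {
  iso :> R -> R * R -> R * R;
  iso_start : forall q, iso 0 q = q;
  iso_bij : forall t, bijective (iso t);
  iso_diff : forall t q, differentiable (iso t) q;
  iso_nondegenerate : forall t q,
    det2 ('D_((1, 0) : R * R) (iso t) q) ('D_((0, 1) : R * R) (iso t) q) != 0;
  iso_continuous : continuous (fun tq : R * (R * R) => iso tq.1 tq.2);
  iso_D_continuous : forall v : R * R,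
    continuous (fun tq : R * (R * R) => 'D_v (iso tq.1) tq.2)
}.

(* A decomposition of the circles of D into consecutive arcs, indexed by A:
   the arc a is the image of [lo a, hi a] in the component [loc a], and its
   endpoint is the starting point of the arc [next a]. *)
Record subdivision (R : realType) (D : diagram R) (A : finType)
    (next : A -> A) := Subdivision {
  loc : A -> comp D;
  lo : A -> R;
  hi : A -> R;
  arc_proper : forall a, lo a < hi a;
  arc_next : forall a,
    same_pt (loc a, hi a) (loc (next a), lo (next a));
  arc_cover : forall x : pt D, exists a s,
    lo a <= s < hi a /\ same_pt (loc a, s) x;
  arc_disjoint : forall a b s t,
    lo a <= s < hi a -> lo b <= t < hi b ->
    same_pt (loc a, s) (loc b, t) -> a = b /\ s = t
}.

(* The copy k - epsilon(p), superscripts being read modulo m. *)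
Definition target_sheet (R : realType) (D : diagram R) (P : cut_points D)
    (m : nat) (p : cut P) (k : 'I_m) : 'I_m :=
  if coherent p then ord_pred k else ordS k.

(* The connecting arc from copy k to copy k - epsilon(p) is the one between
   the copies 0 and m - 1 which closes up the cycle. *)
Definition closes_cycle (R : realType) (D : diagram R) (P : cut_points D)
    (m : nat) (p : cut P) (k : 'I_m) : bool :=
  if coherent p then k == 0%N :> nat else k.+1 == m.

(* The small arcs around the cut points are indexed by [cut P], the pieces of
   the remaining part of D by B.  In the covering, (k, inr b) is the copy in
   D^k of the piece b and (k, inl p) is the arc from p^k_- to
   p^(k - epsilon(p))_+. *)
Definition covering_next (R : realType) (D : diagram R) (P : cut_points D)
    (m : nat) (B : finType) (next : cut P + B -> cut P + B)
    (ka : 'I_m * (cut P + B)) : 'I_m * (cut P + B) :=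
  (match ka.2 with
   | inl p => target_sheet p ka.1
   | inr _ => ka.1
   end, next ka.2).

Definition hshift (R : realType) (c : R) (q : R * R) : R * R := (q.1 + c, q.2).

Definition moved (R : realType) (D : diagram R) (h : isotopy R) :
    comp D -> R -> R * R :=
  fun i t => h 1 (path i t).

(* The line l(p) is y = level h p. *)
Definition level (R : realType) (D : diagram R) (P : cut_points D)
    (h : isotopy R) (p : cut P) : R :=
  (moved h (cut_pos p).1 (cut_pos p).2).2.

(* E is an m-fold cyclic covering diagram phi_m(D, P).  The parametrization
   of E is arbitrary: it is related to that of D by [cov_time].  Since E is a
   diagram, the copies and the connecting arcs fit together to a C^1 curve. *)
Record cyclic_covering (R : realType) (m : nat) (D : diagram R)
    (P : cut_points D) (E : diagram R) := CyclicCovering {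
  cov_iso : isotopy R;
  (* the thin neighborhood of l(p) is a strip of half-width thickness p; the
     conditions on l(p) are imposed on all horizontal lines of the strip *)
  thickness : cut P -> R;
  thickness_gt0 : forall p, 0 < thickness p;
  strip_transverse : forall p (x : pt D),
    `|(moved cov_iso x.1 x.2).2 - level cov_iso p| < thickness p ->
    (velocity (@moved R D cov_iso) x).2 != 0;
  strip_no_crossing : forall p (x : pt D),
    `|(moved cov_iso x.1 x.2).2 - level cov_iso p| < thickness p ->
    ~ at_crossing x;
  strip_no_cut : forall p q, `|level cov_iso q - level cov_iso p| < thickness p ->
    q = p;
  offset : 'I_m -> R;
  offset_incr : forall k l : 'I_m, (k < l)%N -> offset k < offset l;
  copies_disjoint : forall (k l : 'I_m) (x y : pt D), k != l ->
    hshift (offset k) (moved cov_iso x.1 x.2)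
    <> hshift (offset l) (moved cov_iso y.1 y.2);
  piece : finType;
  next : cut P + piece -> cut P + piece;
  sub : subdivision D next;
  small_arc_cut : forall p, exists s,
    lo sub (inl p) < s < hi sub (inl p) /\
    same_pt (loc sub (inl p), s) (cut_pos p);
  small_arc_no_crossing : forall p s,
    lo sub (inl p) <= s <= hi sub (inl p) ->
    ~ at_crossing (loc sub (inl p), s);
  small_arc_next : forall p, exists b, next (inl p) = inr b;
  endpoint_no_crossing : forall a, ~ at_crossing (loc sub a, lo sub a);
  cov_sub : subdivision E (@covering_next R D P m piece next);
  cov_time : 'I_m -> piece -> R -> R;
  cov_time_derivable : forall k b s, derivable (cov_time k b) s 1;
  cov_time_C1 : forall k b, continuous (derive1 (cov_time k b));
  cov_time_incr : forall k b s, 0 < derive1 (cov_time k b) s;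
  cov_time_lo : forall k b,
    cov_time k b (lo cov_sub (k, inr b)) = lo sub (inr b);
  cov_time_hi : forall k b,
    cov_time k b (hi cov_sub (k, inr b)) = hi sub (inr b);
  cov_path : forall k b s,
    lo cov_sub (k, inr b) <= s <= hi cov_sub (k, inr b) ->
    path (loc cov_sub (k, inr b)) s
    = hshift (offset k) (moved cov_iso (loc sub (inr b)) (cov_time k b s));
  (* crossings of the copies keep their type, all other ones are virtual *)
  cov_mark : forall (k : 'I_m) (x : pt D), at_crossing x ->
    mark E (hshift (offset k) (moved cov_iso x.1 x.2)) = mark D (path x.1 x.2);
  connecting_virtual : forall k p s,
    lo cov_sub (k, inl p) <= s <= hi cov_sub (k, inl p) ->
    ~ at_classical (loc cov_sub (k, inl p), s);
  connecting_thin : forall k p s, ~~ closes_cycle p k ->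
    lo cov_sub (k, inl p) <= s <= hi cov_sub (k, inl p) ->
    `|(path (loc cov_sub (k, inl p)) s).2 - level cov_iso p| < thickness p
}.

(* Main.v *)
From mathcomp Require Import all_boot all_order all_algebra.
From mathcomp Require Import all_classical all_reals all_analysis.
From mathcomp Require Import ring lra zify.
Require Import Defs.

(** Let nu be an integer Alexander numbering of D cut along P.  In the covering
    diagram E, give a point lying over a point x of D on the copy D^k the
    number nu(x) + k mod m, and give the whole connecting arc that starts at
    p^k_- the number nu(p_-) + k of its starting point.

    The numbers agree where a connecting arc ends.  When p is coherent, nu
    grows by one through p and the arc descends from copy k to copy k - 1, so
    nu(p_+) + (k - 1) = nu(p_-) + k; when p is incoherent both changes have the
    opposite sign.  Closing up the cycle of copies costs nothing modulo m.
    Hence the only points of E where the numbering changes are the classical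
    crossings.  The rest of the argument is that classical crossings of E are
    the copies of those of D: the connecting arcs have none, different copies
    are disjoint, and inside one copy a double point comes from a double point
    of D of the same kind ([classical_pair], [at_classical_copy]).  At such a
    crossing the rule for E is the rule for D with k added to every number,
    provided the two strands are in the same position.  This holds because the
    final map of an isotopy preserves orientation ([isotopy_orientation]) and
    the reparametrization of the copies is increasing ([det2_velocity_copy]).

    The numbering is described arc by arc; [labelling_of_arcs] turns such a
    description into a labelling of the circles of E. *)

Set Implicit Arguments.
Unset Strict Implicit.
Unset Printing Implicit Defensive.

Import Order.TTheory GRing.Theory Num.Theory.
Import numFieldNormedType.Exports.

Local Open Scope classical_set_scope.
Local Open Scope ring_scope.

(** * Points of the circles *)

Lemma itv_co_cc (R : realType) (a b s : R) : a <= s < b -> a <= s <= b.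
Proof. by case/andP=> -> /ltW. Qed.

Lemma periodic_int (R : realType) (T : Type) (f : R -> T) :
  (forall t, f (t + 1) = f t) -> forall t (n : int), f (t + n%:~R) = f t.
Proof.
move=> f1.
have fn t (n : nat) : f (t + n%:R) = f t.
  by elim: n => [|n IH]; rewrite ?addr0// -natr1 addrA f1.
move=> t [n|n]; first exact: fn.
by rewrite -[in RHS](subrK n.+1%:R t) fn NegzE mulrNz.
Qed.

Section SamePoint.
Context {R : realType} {I : Type}.
Implicit Types x y z : I * R.

Lemma same_pt_refl x : same_pt x x.
Proof. by split=> //; exists 0; rewrite addr0. Qed.

Lemma same_pt_sym x y : same_pt x y -> same_pt y x.
Proof.
case: x y => i s [j t] [/= -> [n ->]]; split=> //=; exists (- n).
by rewrite mulrNz addrK.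
Qed.

Lemma same_pt_trans x y z : same_pt x y -> same_pt y z -> same_pt x z.
Proof.
move=> [d1 [n e1]] [d2 [p e2]]; split; first by rewrite d1.
by exists (n + p); rewrite e2 e1 mulrzDr addrA.
Qed.

Lemma same_pt_shift x y (d : R) :
  same_pt x y -> same_pt (x.1, x.2 + d) (y.1, y.2 + d).
Proof. by move=> [e [n /= ->]]; split=> //; exists n => /=; ring. Qed.

Lemma same_pt_fun (T : Type) (f : I -> R -> T) x y :
  (forall i t, f i (t + 1) = f i t) -> same_pt x y -> f x.1 x.2 = f y.1 y.2.
Proof.
by move=> f1 [-> [n ->]]; rewrite (periodic_int (f1 _)).
Qed.

Lemma meets_sym (f : I -> R -> R * R) x y : meets f x y -> meets f y x.
Proof. by move=> [ne e]; split=> // /same_pt_sym. Qed.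

End SamePoint.

Section DiagramPoints.
Context {R : realType} (D : diagram R).
Implicit Types x y : pt D.

Lemma path_same_pt x y : same_pt x y -> path x.1 x.2 = path y.1 y.2.
Proof. exact: same_pt_fun (@path_periodic R D). Qed.

Lemma meets_same_pt x y x' y' : same_pt x x' -> same_pt y y' ->
  meets (@path R D) x y -> meets (@path R D) x' y'.
Proof.
move=> sx sy [ne e]; split; last first.
  by rewrite -(path_same_pt sx) e (path_same_pt sy).
move=> s; apply: ne; apply: same_pt_trans sx (same_pt_trans s _).
exact: same_pt_sym.
Qed.

Lemma at_crossing_same_pt x x' : same_pt x x' -> at_crossing x -> at_crossing x'.
Proof.
move=> s [y xy]; exists y; apply: meets_same_pt xy => //.
exact: same_pt_refl.
Qed.

Lemma at_classical_same_pt x x' :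
  same_pt x x' -> at_classical x -> at_classical x'.
Proof.
move=> s [c mk]; split; first exact: at_crossing_same_pt s c.
by rewrite -(path_same_pt s).
Qed.

Lemma at_classical_meets x y :
  meets (@path R D) x y -> at_classical x -> at_classical y.
Proof.
by move=> xy [c mk]; split; [exists x; exact: meets_sym|rewrite -xy.2].
Qed.

Lemma velocity_same_pt x y : same_pt x y ->
  velocity (@path R D) x = velocity (@path R D) y.
Proof.
move=> s; apply: (@same_pt_fun _ _ _ (fun i => derive1 (path i)) _ _ _ s) => i t.
rewrite /derive1; set g := fun h : R => _; set g' := fun h : R => _.
suff -> : g = g' by [].
by apply/funext => h; rewrite /g /g' addrA !path_periodic.
Qed.

End DiagramPoints.

(** * Labellings described arc by arc *)

(** Constancy on an interval free of break points is proved by walking along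
    it from arc to arc.  The walk is finite because there are finitely many
    arcs, hence a positive lower bound on their lengths. *)
Lemma labelling_of_arcs (R : realType) (D : diagram R) (A : finType)
    (next : A -> A) (S : subdivision D next) (brk : pt D -> Prop) (T : Type)
    (val : A -> R -> T) :
  (forall x y, same_pt x y -> brk x -> brk y) ->
  (forall a s t, lo S a <= s -> s <= t -> t < hi S a ->
     (forall u, s <= u <= t -> ~ brk (loc S a, u)) -> val a s = val a t) ->
  (forall a s, lo S a <= s < hi S a ->
     (forall u, s <= u <= hi S a -> ~ brk (loc S a, u)) ->
     val a s = val (next a) (lo S (next a))) ->
  exists nu : comp D -> R -> T, labelling brk nu /\
    forall a s, lo S a <= s < hi S a -> nu (loc S a) s = val a s.
Proof.
move=> brkS valC valN.
have cov (x : pt D) : {ab : A * R | lo S ab.1 <= ab.2 < hi S ab.1 /\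
    same_pt (loc S ab.1, ab.2) x}.
  by apply: cid; have [a [s h]] := arc_cover S x; exists (a, s).
pose nu (i : comp D) t := val (sval (cov (i, t))).1 (sval (cov (i, t))).2.
have nuE a s t i : lo S a <= s < hi S a -> same_pt (loc S a, s) (i, t) ->
    nu i t = val a s.
  move=> h e; rewrite /nu; case: (cov _) => -[b u] /= [h' e'].
  by have [-> ->] := arc_disjoint h' h (same_pt_trans e' (same_pt_sym e)).
have nu1 i t : nu i (t + 1) = nu i t.
  have [a [s [h e]]] := arc_cover S (i, t).
  rewrite (nuE a s t)// (nuE a s (t + 1))//.
  by apply: (same_pt_trans e); split=> //; exists 1.
exists nu; split; last by move=> a s h; apply: nuE h _; exact: same_pt_refl.
split=> // i a0 b0 ab nb.
have [c0 [s0 [hs0 e0]]] := arc_cover S (i, a0).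
pose w a := hi S a - lo S a.
have [d d0 dw] : exists2 d : R, 0 < d & forall a, d <= w a.
  exists (w [arg min_(a < c0) w a]%O); first by rewrite subr_gt0 arc_proper.
  by case: Order.TotalTheory.arg_minP => // a _ h b; exact: h.
(* The slack s - lo makes the measure drop by a full arc length at each change
   of arc, including the first one, which may start inside its arc. *)
have key n c s (L : R) : lo S c <= s < hi S c -> 0 <= L ->
    L + (s - lo S c) < d *+ n ->
    (forall u, s <= u <= s + L -> ~ brk (loc S c, u)) ->
    nu (loc S c) s = nu (loc S c) (s + L).
  elim: n c s L => [|n IH] c s L hs L0 Ln nbk.
    by exfalso; move: Ln; rewrite mulr0n; move: hs => /andP[]; lra.
  have [sL|sL] := ltP (s + L) (hi S c).
    rewrite (nuE c s s)//; last exact: same_pt_refl.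
    rewrite (nuE c (s + L) (s + L)); last exact: same_pt_refl.
      by apply: valC => //; [case/andP: hs|lra].
    by rewrite sL andbT; move: hs => /andP[]; lra.
  have [e1 [k e2]] := arc_next S c; rewrite /= in e1 e2.
  rewrite (nuE c s s)//; last exact: same_pt_refl.
  rewrite valN//; last first.
    by move=> u /andP[u1 u2]; apply: nbk; rewrite u1 (le_trans u2).
  have <- : nu (loc S (next c)) (lo S (next c)) = val (next c) (lo S (next c)).
    by apply: nuE; [rewrite lexx arc_proper|exact: same_pt_refl].
  rewrite (IH _ _ (s + L - hi S c)).
  - rewrite e1 e2 -[RHS](periodic_int (nu1 _) _ k); congr nu; ring.
  - by rewrite lexx arc_proper.
  - by rewrite subr_ge0.
  - by rewrite mulrS in Ln; have := dw c; rewrite /w; lra.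
  - move=> u /andP[u1 u2] bu; apply: (nbk (u - k%:~R)).
      by rewrite e2 in u1 u2; case/andP: hs => *; apply/andP; split; lra.
    apply: brkS bu; rewrite -e1; split=> //=; exists (- k).
    by rewrite mulrNz.
have [ei [k ek]] := e0; rewrite /= in ei ek.
rewrite -ei ek -(subrKC (s0 + k%:~R) b0) -ek.
rewrite (_ : a0 + _ = s0 + (b0 - a0) + k%:~R); last by rewrite ek; ring.
rewrite {1}ek !(periodic_int (nu1 _)).
have wn : 0 <= (b0 - a0 + (s0 - lo S c0)) / d.
  by rewrite divr_ge0 ?(ltW d0)// addr_ge0 ?subr_ge0//; case/andP: hs0.
apply: (key (Num.bound ((b0 - a0 + (s0 - lo S c0)) / d))) => //.
- by rewrite subr_ge0.
- by rewrite -mulr_natl -ltr_pdivrMr// archi_boundP.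
- move=> u /andP[u1 u2] bu; apply: (nb (u + k%:~R)).
    by apply/andP; split; lra.
  by apply: brkS bu; rewrite -ei; split=> //; exists k.
Qed.

(** * Orientation under isotopies and reparametrization *)

Lemma det2_linear (R : realType)
    (L : {linear (R * R)%type -> (R * R)%type}) (u v : R * R) :
  det2 (L u) (L v) = det2 (L (1, 0)) (L (0, 1)) * det2 u v.
Proof.
have Lw (w : R * R) : L w = w.1 *: L (1, 0) + w.2 *: L (0, 1).
  rewrite -!linearZ -linearD; congr (L _); case: w => a b /=.
  by congr pair; rewrite /= /GRing.scale /=; ring.
by rewrite (Lw u) (Lw v) /det2 /= /GRing.scale /=; ring.
Qed.

Lemma det2_scale (R : realType) (a b : R) (u v : R * R) :
  det2 (a *: u) (b *: v) = a * b * det2 u v.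
Proof. by rewrite /det2 /= /GRing.scale /=; ring. Qed.

(** The Jacobian of h t is continuous in t, never vanishes, and is 1 at the
    identity map h 0. *)
Lemma isotopy_orientation (R : realType) (h : isotopy R) (t : R) (q : R * R) :
  0 < det2 ('D_((1, 0) : R * R) (h t) q) ('D_((0, 1) : R * R) (h t) q).
Proof.
pose J s := det2 ('D_((1, 0) : R * R) (h s) q) ('D_((0, 1) : R * R) (h s) q).
have J0 : J 0 = 1.
  have id0 : iso h 0 = id by apply/funext => p; exact: iso_start.
  by rewrite /J id0 !derive_id /det2 /=; ring.
have DJ v : continuous (fun s => 'D_(v : R * R) (h s) q).
  move=> s; apply: (@continuous_comp _ _ _ (fun s => (s, q))
    (fun tq : R * (R * R) => 'D_v (h tq.1) tq.2)).
    apply: (@cvg_pair _ _ _ (nbhs s) (nbhs s) (nbhs q) _ _ _ id (cst q)).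
      exact: cvg_id.
    exact: cvg_cst.
  exact: iso_D_continuous.
have D1 v : continuous (fun s => ('D_(v : R * R) (h s) q).1).
  move=> s; apply: (@continuous_comp _ _ _ (fun s => 'D_v (h s) q) fst).
    exact: DJ.
  exact: cvg_fst.
have D2 v : continuous (fun s => ('D_(v : R * R) (h s) q).2).
  move=> s; apply: (@continuous_comp _ _ _ (fun s => 'D_v (h s) q) snd).
    exact: DJ.
  exact: cvg_snd.
have Jc : continuous J.
  move=> s; apply: cvgB; apply: cvgM;
    by [exact: D1|exact: D2|exact: D2|exact: D1].
have Jn0 s : J s != 0 by exact: iso_nondegenerate.
rewrite -/(J t) ltNge; apply/negP => Jt.
have Jw a b : {within `[a, b], continuous J} by exact: continuous_subspaceT.
have [t0|/ltW t0] := leP 0 t.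
  have [|c _ /eqP] := IVT (v := 0) t0 (Jw _ _).
    by rewrite J0 ge_min le_max Jt ler01 orbT.
  by rewrite (negbTE (Jn0 c)).
have [|c _ /eqP] := IVT (v := 0) t0 (Jw _ _); last by rewrite (negbTE (Jn0 c)).
by rewrite J0 ge_min le_max Jt ler01 orbT.
Qed.

Lemma derive1_comp_plane (R : realType) (f : R * R -> R * R)
    (g : R -> R * R) t :
  derivable g t 1 -> differentiable f (g t) ->
  derivable (f \o g) t 1 /\ derive1 (f \o g) t = 'd f (g t) (derive1 g t).
Proof.
move=> /derivable1_diffP dg df.
have dfg := differentiable_comp dg df.
split; first by apply/derivable1_diffP; exact: dfg.
rewrite (derive1E' dfg) (congr1 (fun F => F 1) (diff_comp dg df)) /=.
by congr ('d f (g t) _); rewrite (derive1E' dg).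
Qed.

Lemma derive1_comp_time (R : realType) (g : R -> R * R) (u : R -> R) t :
  derivable u t 1 -> derivable g (u t) 1 ->
  derivable (g \o u) t 1 /\ derive1 (g \o u) t = derive1 u t *: derive1 g (u t).
Proof.
move=> /derivable1_diffP du /derivable1_diffP dg.
have dgu := differentiable_comp du dg.
split; first by apply/derivable1_diffP; exact: dgu.
rewrite (derive1E' dgu) (congr1 (fun F => F 1) (diff_comp du dg)) /=.
rewrite (derive1E' du) (derive1E' dg) -linearZ.
by congr ('d g (u t) _); rewrite /GRing.scale /= mulr1.
Qed.

Lemma derive1_hshift (R : realType) (c : R) (g : R -> R * R) t :
  derivable g t 1 -> derive1 (fun s => hshift c (g s)) t = derive1 g t.
Proof.
move=> dg; have -> : (fun s => hshift c (g s)) = g + cst (c, 0).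
  by apply/funext => s; rewrite /hshift -[X in (_, X)]addr0.
have dc : derivable (cst (c, 0) : R -> R * R) t 1 by exact: derivable_cst.
by rewrite !derive1E (deriveD dg dc) derive_cst addr0.
Qed.

Lemma hshift_inj (R : realType) (c : R) : injective (@hshift R c).
Proof. by move=> [a b] [a' b'] [/addIr -> ->]. Qed.

(** * Residues modulo m *)

Section Residue.
Context {m : nat} (hm : (0 < m)%N).

Lemma absz_mod_lt (z : int) : (`|(z %% m)%Z| < m)%N.
Proof. by have := ltz_mod z (d := m); have := modz_ge0 z (d := m); lia. Qed.

(** The class of an integer modulo m, in the representation of Z / m Z on
    which [ordS] is the successor. *)
Definition residue (z : int) : 'I_m := Ordinal (absz_mod_lt z).

Lemma residue_eq (y z : int) : (y = z %[mod m])%Z -> residue y = residue z.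
Proof. by move=> e; apply: val_inj; rewrite /= e. Qed.

Lemma residueS (z : int) : residue (z + 1) = ordS (residue z).
Proof.
apply: val_inj => /=.
have z0 : 0 <= (z %% m)%Z by rewrite modz_ge0; lia.
apply/eqP; rewrite -eqz_nat gez0_abs; last by rewrite modz_ge0; lia.
by rewrite -modz_nat -addn1 PoszD gez0_abs// modzDml.
Qed.

Lemma residueD_ordS (z : int) (k : 'I_m) :
  residue (z + (ordS k : nat)%:Z) = residue (z + (k : nat)%:Z + 1).
Proof.
by apply: residue_eq; rewrite /= -modz_nat modzDmr -addn1 PoszD addrA.
Qed.

Lemma residueD_ord_pred (z : int) (k : 'I_m) :
  residue (z + 1 + (ord_pred k : nat)%:Z) = residue (z + (k : nat)%:Z).
Proof.
by rewrite -[in RHS](ord_predK k) residueD_ordS addrAC.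
Qed.

End Residue.

(** * Classical crossings of the covering diagram *)

Section Covering.
Context {R : realType} {m : nat} {D : diagram R} {P : cut_points D}.
Context {E : diagram R} (C : cyclic_covering m P E).
Local Notation S := (sub C).
Local Notation SE := (cov_sub C).
Local Notation tau := (@cov_time _ _ _ _ _ C).

Lemma cov_time_lt k b : {mono tau k b : s t / s < t}.
Proof.
apply/leW_mono/le_mono => s t st.
have ct : {within `[s, t], continuous (tau k b)}.
  by apply: derivable_within_continuous => u _; exact: cov_time_derivable.
apply: (gtr0_derive1_incr _ _ ct) => // u _; [exact: cov_time_derivable|].
exact: cov_time_incr.
Qed.

Lemma cov_time_le k b : {mono tau k b : s t / s <= t}.
Proof. by move=> s t; rewrite !leNgt cov_time_lt. Qed.

Lemma cov_time_surj k b s t v : s <= t -> tau k b s <= v <= tau k b t ->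
  exists2 u, s <= u <= t & tau k b u = v.
Proof.
move=> st /andP[sv vt].
have ct : {within `[s, t], continuous (tau k b)}.
  by apply: derivable_within_continuous => u _; exact: cov_time_derivable.
have [|u us <-] := IVT st ct (v := v).
  by rewrite ge_min le_max sv vt orbT.
by exists u.
Qed.

Lemma cov_time_range k b s : lo SE (k, inr b) <= s < hi SE (k, inr b) ->
  lo S (inr b) <= tau k b s < hi S (inr b).
Proof.
by rewrite -(cov_time_lo k b) -(cov_time_hi k b) cov_time_le cov_time_lt.
Qed.

(** Reparametrization maps each half-open arc of a copy onto the arc of D that
    it copies, so crossings of D can be lifted to the copies. *)
Lemma cov_time_lift k b v : lo S (inr b) <= v < hi S (inr b) ->
  exists2 s, lo SE (k, inr b) <= s < hi SE (k, inr b) & tau k b s = v.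
Proof.
move=> /andP[lv vh].
have [||s /andP[ls sh] sv] :=
    @cov_time_surj k b (lo SE (k, inr b)) (hi SE (k, inr b)) v.
- exact/ltW/arc_proper.
- by rewrite cov_time_lo cov_time_hi lv ltW.
- by exists s => //; rewrite ls -(cov_time_lt k b) sv cov_time_hi.
Qed.

(** By [small_arc_cut] each cut point is interior to its own small arc, and
    the arcs are disjoint, so that the remaining pieces, endpoints included,
    have none. *)
Lemma cut_in_arc a s : lo S a <= s <= hi S a -> at_cut P (loc S a, s) ->
  exists p, [/\ a = inl p, lo S a < s < hi S a &
    same_pt (cut_pos p) (loc S a, s)].
Proof.
move=> /andP[ls sh] [p ps]; have [s0 [/andP[l0 h0] e0]] := small_arc_cut C p.
have i0 : lo S (inl p) <= s0 < hi S (inl p) by rewrite (ltW l0).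
have s0s := same_pt_trans e0 ps.
move: sh; rewrite le_eqVlt => /orP[/eqP sh|sh].
  (* A cut point at the end of a would be at the start of the next arc. *)
  have nx := arc_next S a; rewrite -sh in nx.
  have [|e1 e2] := arc_disjoint i0 _ (same_pt_trans s0s nx).
    by rewrite lexx arc_proper.
  by move: l0; rewrite e2 -e1 ltxx.
have [|e1 e2] := arc_disjoint i0 _ s0s; first by rewrite ls.
by exists p; split=> //; rewrite -e1 -e2 l0.
Qed.

Lemma crossing_in_arc a s : lo S a <= s < hi S a -> at_crossing (loc S a, s) ->
  exists b, a = inr b /\ lo S a < s.
Proof.
move=> /andP[ls sh] cr; case: a => [p|b] in ls sh cr *.
  by case: (@small_arc_no_crossing _ _ _ _ _ C p s) => //; rewrite ls ltW.
exists b; split=> //; rewrite lt_neqAle ls andbT; apply/eqP => e.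
by apply: (@endpoint_no_crossing _ _ _ _ _ C (inr b)); rewrite e.
Qed.

Lemma moved_inj i s j t : moved (cov_iso C) i s = moved (cov_iso C) j t ->
  @path R D i s = @path R D j t.
Proof. exact: (bij_inj (iso_bij (cov_iso C) 1)). Qed.

(** The arcs of the subdivisions are injectively parametrized, which is what
    makes distinct points of D correspond to distinct points of the copy. *)
Lemma meets_copy k b s b' s' :
  lo SE (k, inr b) <= s < hi SE (k, inr b) ->
  lo SE (k, inr b') <= s' < hi SE (k, inr b') ->
  meets (@path R E) (loc SE (k, inr b), s) (loc SE (k, inr b'), s') <->
  meets (@path R D) (loc S (inr b), tau k b s) (loc S (inr b'), tau k b' s').
Proof.
move=> hs hs'.
have ws := itv_co_cc hs.
have ws' := itv_co_cc hs'.
split=> -[ne e]; rewrite /= in e; split=> [sm|/=].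
- have [[eb]] := arc_disjoint (cov_time_range hs) (cov_time_range hs') sm.
  rewrite -eb => et; apply: ne.
  have -> : s = s' by apply: (inc_inj (@cov_time_le k b)).
  by rewrite eb; exact: same_pt_refl.
- by move: e; rewrite !cov_path// => /hshift_inj/moved_inj.
- have [[eb] et] := arc_disjoint hs hs' sm; apply: ne.
  by rewrite eb et; exact: same_pt_refl.
- by rewrite !cov_path// /moved e.
Qed.

(** Contrapositively, no classical crossing of D lies under an interval of E
    without classical crossings; this keeps the numbering constant there. *)
Lemma at_classical_copy k b s :
  lo SE (k, inr b) <= s < hi SE (k, inr b) ->
  at_classical (loc S (inr b), tau k b s) ->
  at_classical (loc SE (k, inr b), s).
Proof.
move=> hs cl; have [cr mk] := cl; have [y xy] := cr.
have ws := itv_co_cc hs.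
split; last by rewrite /= cov_path// (cov_mark C k cr).
have [a [v [hv vy]]] := arc_cover S y.
have xv : meets (@path R D) (loc S (inr b), tau k b s) (loc S a, v).
  by apply: meets_same_pt xy; [exact: same_pt_refl|exact: same_pt_sym].
have [|b' [ab _]] := crossing_in_arc hv.
  by exists (loc S (inr b), tau k b s); exact: meets_sym.
rewrite {}ab in hv xv; have [s' hs' e'] := cov_time_lift k hv.
by exists (loc SE (k, inr b'), s'); apply/meets_copy; rewrite ?e'.
Qed.

Lemma classical_in_copy (x : pt E) : at_classical x ->
  exists k b s, lo SE (k, inr b) <= s < hi SE (k, inr b) /\
    same_pt (loc SE (k, inr b), s) x.
Proof.
move=> clx; have [[k [p|b]] [s [hs sx]]] := arc_cover SE x; last first.
  by exists k, b, s.
have ws := itv_co_cc hs.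
case: (connecting_virtual ws); exact: at_classical_same_pt (same_pt_sym sx) clx.
Qed.

(** Both strands run on copies, since connecting arcs have only virtual
    crossings, and on the same copy, since different copies are disjoint.  The
    parameters are interior to their arcs because endpoints of arcs are not
    crossings; this leaves room to compare both sides of the crossing. *)
Lemma classical_pair (x y : pt E) : at_classical x -> meets (@path R E) x y ->
  exists k b s b' s',
    [/\ lo SE (k, inr b) < s < hi SE (k, inr b),
        lo SE (k, inr b') < s' < hi SE (k, inr b'),
        same_pt (loc SE (k, inr b), s) x,
        same_pt (loc SE (k, inr b'), s') y &
        let x' := (loc S (inr b), tau k b s) in
        meets (@path R D) x' (loc S (inr b'), tau k b' s') /\ at_classical x'].
Proof.
move=> clx xy; have cly := at_classical_meets xy clx.
have [k [b [s [hs sx]]]] := classical_in_copy clx.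
have [l [b' [s' [hs' sy]]]] := classical_in_copy cly.
have ws := itv_co_cc hs.
have ws' := itv_co_cc hs'.
have xy' : meets (@path R E) (loc SE (k, inr b), s) (loc SE (l, inr b'), s').
  by apply: meets_same_pt xy; exact: same_pt_sym.
have [e|kl] := eqVneq k l; last first.
  have := xy'.2; rewrite /= !cov_path// => e.
  by case: (copies_disjoint (x := (_, _)) (y := (_, _)) kl e).
subst l; have m' := (meets_copy hs hs').1 xy'.
have crx : at_crossing (loc S (inr b), tau k b s).
  by exists (loc S (inr b'), tau k b' s').
have cry : at_crossing (loc S (inr b'), tau k b' s').
  by exists (loc S (inr b), tau k b s); exact: meets_sym.
have [_ [_ lx]] := crossing_in_arc (cov_time_range hs) crx.
have [_ [_ ly]] := crossing_in_arc (cov_time_range hs') cry.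
exists k, b, s, b', s'; split=> //.
- by case/andP: hs => _ ->; rewrite -(cov_time_lt k b) cov_time_lo lx.
- by case/andP: hs' => _ ->; rewrite -(cov_time_lt k b') cov_time_lo ly.
- split=> //; split=> //.
  have [_] := at_classical_same_pt (same_pt_sym sx) clx.
  by rewrite /= cov_path// (cov_mark C k crx).
Qed.

(** The open interval matters: at an endpoint, [cov_path] constrains only one
    side of the path of E. *)
Lemma velocity_copy k b s : lo SE (k, inr b) < s < hi SE (k, inr b) ->
  velocity (@path R E) (loc SE (k, inr b), s) =
  derive1 (tau k b) s *:
    'd (cov_iso C 1) (path (loc S (inr b)) (tau k b s))
      (velocity (@path R D) (loc S (inr b), tau k b s)).
Proof.
move=> hs; pose g := path (loc S (inr b)).
have [dg eg] := derive1_comp_plane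
  (@path_derivable R D (loc S (inr b)) (tau k b s))
  (iso_diff (cov_iso C) 1 (g (tau k b s))).
have [dgt egt] := derive1_comp_time (@cov_time_derivable _ _ _ _ _ C k b s) dg.
rewrite /velocity /= -eg -egt -(derive1_hshift (offset C k) dgt) !derive1E.
apply: near_eq_derive.
have s_in : s \in `]lo SE (k, inr b), hi SE (k, inr b)[ by rewrite in_itv.
apply: filterS (near_in_itvoo s_in) => u; rewrite /= in_itv /= => /andP[lu uh].
by apply: cov_path; rewrite !ltW.
Qed.

(** The two velocities are multiplied by positive factors and mapped by the same
    differential, whose determinant is positive. *)
Lemma det2_velocity_copy k b s b' s' :
  lo SE (k, inr b) < s < hi SE (k, inr b) ->
  lo SE (k, inr b') < s' < hi SE (k, inr b') ->
  path (loc S (inr b)) (tau k b s) = path (loc S (inr b')) (tau k b' s') ->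
  det2 (velocity (@path R E) (loc SE (k, inr b), s))
       (velocity (@path R E) (loc SE (k, inr b'), s')) < 0 ->
  det2 (velocity (@path R D) (loc S (inr b), tau k b s))
       (velocity (@path R D) (loc S (inr b'), tau k b' s')) < 0.
Proof.
move=> hs hs' e; rewrite !velocity_copy// e det2_scale det2_linear.
set q := path _ _; rewrite mulrA pmulr_rlt0//.
rewrite !mulr_gt0 ?cov_time_incr//.
have dq := iso_diff (cov_iso C) 1 q.
by rewrite -!(deriveE _ dq) isotopy_orientation.
Qed.

End Covering.

(** * The numbering of the covering diagram *)

Lemma near_right0P (R : realType) (Q : R -> Prop) :
  (\forall e \near 0^'+, Q e) <->
  exists2 d : R, 0 < d & forall e, 0 < e < d -> Q e.
Proof.
split=> [[d /= d0 dQ]|[d d0 dQ]].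
  exists d => // e /andP[e0 ed]; apply: dQ => //.
  by rewrite /ball_/= sub0r normrN gtr0_norm.
exists d => //= e; rewrite /ball_/= sub0r normrN => ed e0; apply: dQ.
by rewrite e0 -(gtr0_norm e0).
Qed.

Section Numbering.
Context {R : realType} {m : nat} {D : diagram R} {P : cut_points D}.
Context {E : diagram R} (C : cyclic_covering m P E) (hm : (0 < m)%N).
Context (nu : comp D -> R -> int)
  (nuL : labelling (fun x => at_classical x \/ at_cut P x) nu).
Local Notation S := (sub C).
Local Notation SE := (cov_sub C).
Local Notation tau := (@cov_time _ _ _ _ _ C).

Definition cov_number (ka : 'I_m * (cut P + piece C)) (s : R) : 'I_m :=
  residue hm
    (match ka.2 with
     | inl p => nu (loc S (inl p)) (lo S (inl p))
     | inr b => nu (loc S (inr b)) (tau ka.1 b s)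
     end + (ka.1 : nat)%:Z).

(** The cut rule speaks of the immediate vicinity of p; it extends to the ends
    of the small arc because this arc has no crossing and no other cut point. *)
Lemma jump_small_arc (nuC : cut_rule P nu) p :
  let i := loc S (inl p) in
  if coherent p then nu i (hi S (inl p)) = nu i (lo S (inl p)) + 1
  else nu i (lo S (inl p)) = nu i (hi S (inl p)) + 1.
Proof.
move=> i; have [s [/andP[ls sh] ps]] := small_arc_cut C p.
have [nu1 nuc] := nuL.
have [d d0 dP] := (near_right0P _).1 (nuC p).
pose e := Order.min d (Order.min (s - lo S (inl p)) (hi S (inl p) - s)) / 2.
have [e0 ed el eh] :
    [/\ 0 < e, e < d, lo S (inl p) < s - e & s + e < hi S (inl p)].
  have : 0 < Order.min d (Order.min (s - lo S (inl p)) (hi S (inl p) - s)).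
    by rewrite !lt_min d0 !subr_gt0 ls.
  rewrite /e; set w := Order.min _ _ => w0.
  have : w <= d by rewrite ge_min lexx.
  have : w <= s - lo S (inl p) by rewrite !ge_min lexx orbT.
  have : w <= hi S (inl p) - s by rewrite !ge_min lexx !orbT.
  by split; lra.
have {}ed : 0 < e < d by rewrite e0.
have near_cut r : nu (cut_pos p).1 ((cut_pos p).2 + r) = nu i (s + r).
  by rewrite -(same_pt_fun nu1 (same_pt_shift r ps)).
have jump := dP e ed; rewrite !near_cut in jump.
have only t : lo S (inl p) <= t <= hi S (inl p) -> t != s ->
    ~ (at_classical (i, t) \/ at_cut P (i, t)).
  move=> ht ts [[cr _]|cu]; first exact: small_arc_no_crossing ht cr.
  have [q [[<-] /andP[lt th] qt]] := cut_in_arc ht cu.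
  have [||_ st] := arc_disjoint _ _ (same_pt_trans ps qt); try by rewrite ltW.
  by rewrite st eqxx in ts.
have -> : nu i (lo S (inl p)) = nu i (s - e).
  apply: nuc => [|t /andP[t1 t2]]; first exact: ltW.
  by apply: only; [apply/andP; split; lra|rewrite lt_eqF//; lra].
have <- : nu i (s + e) = nu i (hi S (inl p)).
  apply: nuc => [|t /andP[t1 t2]]; first exact: ltW.
  by apply: only; [apply/andP; split; lra|rewrite gt_eqF//; lra].
exact: jump.
Qed.

(** Over the interior of the arc this is [at_classical_copy].  When t is the end
    of the arc, it lies over the endpoint of a piece of D, which is neither a
    crossing nor a cut point. *)
Lemma no_break_copy k b s t : lo SE (k, inr b) <= s -> s <= t ->
  t <= hi SE (k, inr b) ->
  (forall u, s <= u <= t -> ~ at_classical (loc SE (k, inr b), u)) ->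
  nu (loc S (inr b)) (tau k b s) = nu (loc S (inr b)) (tau k b t).
Proof.
move=> ls st th ncl; apply: nuL.2; first by rewrite cov_time_le.
move=> v hv; have [u /andP[su ut] uv] := cov_time_surj st hv.
have lu : lo SE (k, inr b) <= u by exact: le_trans su.
have uh : u <= hi SE (k, inr b) by exact: le_trans ut th.
case=> [cl|cu].
  move: uh; rewrite le_eqVlt => /orP[/eqP uh|uh].
    have [cr _] := cl.
    apply: (@endpoint_no_crossing _ _ _ _ _ C (next (inr b))).
    apply: at_crossing_same_pt (arc_next S (inr b)) _.
    by rewrite -(cov_time_hi k b) -uh uv.
  apply: (ncl u); first by rewrite su.
  by apply: at_classical_copy; rewrite ?lu// uv.
have [|p [//]] := @cut_in_arc _ _ _ _ _ C (inr b) v _ cu.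
by rewrite -uv -(cov_time_lo k b) -(cov_time_hi k b) !cov_time_le lu.
Qed.

(** Consecutive arcs fit: between two pieces or from a piece to a small arc,
    the sheet is unchanged and nu is constant; after a small arc, the jump of nu
    at the cut point is compensated by the change of sheet. *)
Lemma cov_number_labelling (nuC : cut_rule P nu) :
  exists nuE : comp E -> R -> 'I_m, labelling (@at_classical R E) nuE /\
    forall a s, lo SE a <= s < hi SE a -> nuE (loc SE a) s = cov_number a s.
Proof.
apply: labelling_of_arcs => [x y|[k [p|b]] s t ls st th ncl|[k [p|b]] s hs ncl].
- exact: at_classical_same_pt.
- by [].
- by congr residue; rewrite /= (no_break_copy ls st (ltW th) ncl).
- have [b e] := small_arc_next C p.
  rewrite /covering_next /cov_number /= e /= cov_time_lo /target_sheet.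
  have := jump_small_arc nuC p.
  have /= := same_pt_fun nuL.1 (arc_next S (inl p)); rewrite e => ->.
  by case: coherent => ->; rewrite ?residueD_ord_pred ?residueD_ordS// addrAC.
- case/andP: hs => ls sh.
  have e := no_break_copy ls (ltW sh) (lexx _) ncl.
  have /= e' := same_pt_fun nuL.1 (arc_next S (inr b)).
  rewrite /covering_next /cov_number /= e cov_time_hi e'.
  by case: (next (inr b)) => [p|b'] //=; rewrite cov_time_lo.
Qed.

(** One-sided limits of the numbering at an interior point of a copy.  The sign
    sg selects the side; reparametrization preserves it, being increasing. *)
Lemma near_copy (nuE : comp E -> R -> 'I_m) (sg : R) k b s (x : pt E) n :
  (forall i t, nuE i (t + 1) = nuE i t) ->
  (forall a s, lo SE a <= s < hi SE a -> nuE (loc SE a) s = cov_number a s) ->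
  sg = 1 \/ sg = -1 ->
  lo SE (k, inr b) < s < hi SE (k, inr b) ->
  same_pt (loc SE (k, inr b), s) x ->
  (\forall e \near 0^'+, nu (loc S (inr b)) (tau k b s + sg * e) = n) ->
  \forall e \near 0^'+, nuE x.1 (x.2 + sg * e) = residue hm (n + (k : nat)%:Z).
Proof.
move=> nu1 nuEE sgP /andP[ls sh] sx /near_right0P[d d0 dn].
have [r /= r0 rd] : \forall u \near s, `|tau k b s - tau k b u| < d.
  have /derivable1_diffP := @cov_time_derivable _ _ _ _ _ C k b s.
  by move=> /differentiable_continuous/cvgrPdist_lt/(_ _ d0).
apply/near_right0P.
pose w := Order.min r (Order.min (s - lo SE (k, inr b)) (hi SE (k, inr b) - s)).
exists w; first by rewrite !lt_min r0 !subr_gt0 ls.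
move=> e /andP[e0]; rewrite !lt_min => /andP[er /andP[el eh]].
have -> : nuE x.1 (x.2 + sg * e) = nuE (loc SE (k, inr b)) (s + sg * e).
  by rewrite -(same_pt_fun nu1 (same_pt_shift (sg * e) sx)).
have rng : lo SE (k, inr b) <= s + sg * e < hi SE (k, inr b).
  by case: sgP => ->; apply/andP; split; lra.
rewrite nuEE//; congr residue => /=; congr (_ + _).
(* The parameter distance in D that corresponds to e in E. *)
pose e' := sg * (tau k b (s + sg * e) - tau k b s).
have -> : tau k b (s + sg * e) = tau k b s + sg * e'.
  by rewrite /e'; case: sgP => ->; ring.
apply: dn; apply/andP; split.
  rewrite /e'; case: sgP => ->.
    by rewrite mul1r subr_gt0 cov_time_lt; lra.
  by rewrite mulN1r oppr_gt0 subr_lt0 cov_time_lt; lra.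
apply: le_lt_trans (rd (s + sg * e) _).
  by rewrite distrC (le_trans (ler_norm _))// /e'; case: sgP => ->;
    rewrite ?mul1r// mulN1r normrN.
by rewrite /ball_ /= opprD addNKr; case: sgP => ->;
  rewrite ?mul1r ?mulN1r ?opprK ?normrN gtr0_norm.
Qed.

End Numbering.

Theorem proposition4 (R : realType) (m : nat) (hm : (1 <= m)%N)
    (D : diagram R) (P : cut_points D) (E : diagram R)
    (hP : cut_system P) (hE : cyclic_covering m P E) :
  mod_almost_classical m E.
Proof.
have [nu [nuL nuX nuC]] := hP.
have [nuE [[nuE1 nuEc] nuEE]] := cov_number_labelling hE hm nuL nuC.
exists nuE; split=> // x y clx xy xyneg.
have [k [b [s [b' [s' [hs hs' sx sy [xy' clx']]]]]]] := classical_pair hE clx xy.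
rewrite -(velocity_same_pt sx) -(velocity_same_pt sy) in xyneg.
have := nuX _ _ clx' xy' (det2_velocity_copy hs hs' xy'.2 xyneg).
move=> [n /= nearn].
exists (residue hm (n + (k : nat)%:Z)).
have sgn : (1 : R) = 1 \/ (1 : R) = -1 by left.
have sgN : (-1 : R) = 1 \/ (-1 : R) = -1 by right.
have x_before : \forall e \near 0^'+,
    nuE x.1 (x.2 + -1 * e) = residue hm (n + (k : nat)%:Z).
  apply: near_copy nuE1 nuEE sgN hs sx _.
  by apply: filterS nearn => e []; rewrite mulN1r.
have y_after : \forall e \near 0^'+,
    nuE y.1 (y.2 + 1 * e) = residue hm (n + (k : nat)%:Z).
  apply: near_copy nuE1 nuEE sgn hs' sy _.
  by apply: filterS nearn => e []; rewrite mul1r.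
have y_before : \forall e \near 0^'+,
    nuE y.1 (y.2 + -1 * e) = residue hm (n + 1 + (k : nat)%:Z).
  apply: near_copy nuE1 nuEE sgN hs' sy _.
  by apply: filterS nearn => e []; rewrite mulN1r.
have x_after : \forall e \near 0^'+,
    nuE x.1 (x.2 + 1 * e) = residue hm (n + 1 + (k : nat)%:Z).
  apply: near_copy nuE1 nuEE sgn hs sx _.
  by apply: filterS nearn => e []; rewrite mul1r.
near=> e; split.
- by rewrite -mulN1r; near: e.
- by rewrite -[e]mul1r; near: e.
- by rewrite -mulN1r -residueS addrAC; near: e.
- by rewrite -[e]mul1r -residueS addrAC; near: e.
Unshelve. all: by end_near.
Qed.
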